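(* Let $J \subseteq \mathbb{R}$ be an open set and consider $t_0 \in J$. Let $\mathcal{A}\colon J \to \mathbb{C}_{n,m}$ and $\mathcal{D}, \mathcal{E}\colon J \to \mathbb{C}_{m,n}$ be functions such that $\mathcal{A}(t)$ is $(\mathcal{D}(t), \mathcal{E}(t))$-invertible for any $t \in J$, and such that $\mathcal{A}$, $\mathcal{D}$ and $\mathcal{E}$ are differentiable at $t_0$. Suppose that $f\colon J\to \mathbb{C}_{m,n}$, $f(t)= \mathcal{A}(t)^{\parallel (\mathcal{D}(t),\mathcal{E}(t))}$, is a bounded function in $J$ and that the functions $\mathcal{D}$, $\mathcal{E}$ have local constant rank in $J$. Then the function $f$ is differentiable at $t_0$ and $$\begin{aligned} f'(t_0)&=\mathcal{A}(t_0)^{\parallel (\mathcal{D}(t_0),\mathcal{E}(t_0))}\left[\mathcal{G}'(t_0)\mathcal{E}(t_0)+\mathcal{G}(t_0)\mathcal{E}'(t_0)\right]\left[I_n - \mathcal{A}(t_0) \mathcal{A}(t_0)^{\parallel (\mathcal{D}(t_0),\mathcal{E}(t_0))}\right] \\ &\quad + \left[I_m - \mathcal{A}(t_0)^{\parallel (\mathcal{D}(t_0),\mathcal{E}(t_0))}\mathcal{A}(t_0) \right]\left[\mathcal{D}'(t_0)\mathcal{F}(t_0)+\mathcal{D}(t_0)\mathcal{F}'(t_0)\right]\mathcal{A}(t_0)^{\parallel (\mathcal{D}(t_0),\mathcal{E}(t_0))}\\ &\quad + \mathcal{A}(t_0)^{\parallel (\mathcal{D}(t_0),\mathcal{E}(t_0))}\mathcal{A}'(t_0)\mathcal{A}(t_0)^{\parallel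 (\mathcal{D}(t_0),\mathcal{E}(t_0))}, \end{aligned}$$ where $\mathcal{F}, \mathcal{G}\colon J\to \mathbb{C}_{n,m}$ are the functions $\mathcal{F}(t)=(\mathcal{D}(t))^\dagger$ and $\mathcal{G}(t)=(\mathcal{E}(t))^\dagger$.
   Context: $\mathbb{C}_{m,n}$ is the set of $m\times n$ complex matrices ($m,n\in\mathbb{N}$), with its usual (norm) topology; $I_n$ is the identity matrix of order $n$; $M^\dagger$ is the Moore-Penrose inverse of $M$. For a matrix $M\in\mathbb{C}_{p,q}$, $\mathcal{R}(M)$ is its column space and $\mathcal{N}(M)=\{\mathbf{x}\in\mathbb{C}^q: M\mathbf{x}=\mathbf{0}\}$ its null space. For $A \in \mathbb{C}_{n,m}$ and $D,E \in \mathbb{C}_{m,n}$, $A$ is $(D,E)$-invertible if there exists $X\in\mathbb{C}_{m,n}$ such that $XAD=D$, $EAX=E$, $\mathcal{R}(X)\subseteq\mathcal{R}(D)$ and $\mathcal{N}(E)\subseteq\mathcal{N}(X)$. Such an $X$ is unique if it exists; it is called the $(D,E)$-inverse of $A$ and denoted $A^{\parallel (D,E)}$. A matrix-valued function on $J$ has local constant rank in $J$ if every point of $J$ has a neighbourhood in $J$ on which its rank is constant.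
   Formalization: The last term of the formula for f'(t_0) is taken with a minus sign instead of the printed plus; as printed the formula fails for m=n=1, A(t)=t, D=E=1, t_0=1, where f(t)=1/t has f'(1)=-1 and not +1. *)

(* Defs.v *)
From HB Require Import structures.
From mathcomp Require Import all_boot all_order all_algebra.
From mathcomp Require Import complex.
From mathcomp Require Import all_classical all_reals all_analysis.

Set Implicit Arguments.
Unset Strict Implicit.
Unset Printing Implicit Defensive.

Import Order.TTheory GRing.Theory Num.Theory.
Import numFieldNormedType.Exports.

Local Open Scope classical_set_scope.
Local Open Scope ring_scope.
Local Open Scope complex_scope.
Local Open Scope sesquilinear_scope.

Section Inverses.
Context {C : numClosedFieldType}.

Definition colspace p q (M : 'M[C]_(p, q)) : set 'cV[C]_p :=
  range (fun x : 'cV[C]_q => M *m x).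

Definition nullspace p q (M : 'M[C]_(p, q)) : set 'cV[C]_q :=
  [set x | M *m x = 0].

Definition is_de_inverse n m (A : 'M[C]_(n, m)) (D E X : 'M[C]_(m, n)) : Prop :=
  [/\ X *m A *m D = D, E *m A *m X = E,
      colspace X `<=` colspace D & nullspace E `<=` nullspace X].

Definition de_invertible n m (A : 'M[C]_(n, m)) (D E : 'M[C]_(m, n)) : Prop :=
  exists X, is_de_inverse A D E X.

Definition de_inverse n m (A : 'M[C]_(n, m)) (D E : 'M[C]_(m, n)) :
  'M[C]_(m, n) := xget 0 [set X | is_de_inverse A D E X].

Definition is_moore_penrose p q (M : 'M[C]_(p, q)) (X : 'M[C]_(q, p)) : Prop :=
  [/\ M *m X *m M = M, X *m M *m X = X,
      (M *m X) ^t* = M *m X & (X *m M) ^t* = X *m M].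

Definition moore_penrose p q (M : 'M[C]_(p, q)) : 'M[C]_(q, p) :=
  xget 0 [set X | is_moore_penrose M X].

Lemma mulmx_cV_inj p q (M N : 'M[C]_(p, q)) :
  (forall x : 'cV[C]_q, M *m x = N *m x) -> M = N.
Proof.
move=> MN; apply/matrixP => i j.
by have /colP/(_ i) := MN (delta_mx j 0); rewrite -!colE !mxE.
Qed.

Lemma is_de_inverse_unique n m (A : 'M[C]_(n, m)) (D E X Y : 'M[C]_(m, n)) :
  is_de_inverse A D E X -> is_de_inverse A D E Y -> X = Y.
Proof.
move=> [_ EX RX _] [YD _ _ NY]; transitivity (Y *m A *m X).
  apply: mulmx_cV_inj => x; have [|z _ /= Dz] := RX (X *m x); first by exists x.
  by rewrite -[RHS]mulmxA -Dz [RHS]mulmxA YD.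
apply: mulmx_cV_inj => x; apply/eqP; rewrite eq_sym -subr_eq0 -!mulmxA -mulmxBr.
apply/eqP/(NY (x - A *m (X *m x))).
by rewrite /nullspace/= mulmxBr !mulmxA EX subrr.
Qed.

Lemma de_inverseP n m (A : 'M[C]_(n, m)) (D E : 'M[C]_(m, n)) :
  de_invertible A D E -> is_de_inverse A D E (de_inverse A D E).
Proof. by move=> [X AX]; exact: (xgetPex 0 (ex_intro _ X AX)). Qed.

Lemma trmxC_mul p q r (M : 'M[C]_(p, q)) (N : 'M[C]_(q, r)) :
  (M *m N) ^t* = N ^t* *m M ^t*.
Proof. by rewrite trmx_mul map_mxM. Qed.

Lemma mulmx_trmxC_eq0 p q (M : 'M[C]_(p, q)) : M *m M ^t* = 0 -> M = 0.
Proof.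
move=> M0; apply/matrixP => i j; rewrite mxE; apply/eqP.
have /matrixP/(_ i i) := M0; rewrite !mxE => /eqP.
rewrite psumr_eq0 => [/allP/(_ j)|k _]; last by rewrite !mxE mul_conjC_ge0.
by rewrite mem_index_enum !mxE mul_conjC_eq0 => /(_ isT).
Qed.

Lemma row_free_gram p q (M : 'M[C]_(p, q)) :
  row_free M -> M *m M ^t* \in unitmx.
Proof.
move=> Mfree; rewrite -row_free_unit -kermx_eq0.
set K := kermx _; have K0 : K *m (M *m M ^t*) = 0 by exact: mulmx_ker.
apply/eqP/(row_free_inj Mfree); rewrite mul0mx; apply: mulmx_trmxC_eq0.
by rewrite trmxC_mul -mulmxA (mulmxA M) mulmxA K0 mul0mx.
Qed.

Lemma moore_penrose_unique p q (M : 'M[C]_(p, q)) (X Y : 'M[C]_(q, p)) :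
  is_moore_penrose M X -> is_moore_penrose M Y -> X = Y.
Proof.
move=> [MXM XMX hMX hXM] [MYM YMY hMY hYM].
have eMX : M *m X = M *m Y.
  by rewrite -hMX -{1}MYM -mulmxA trmxC_mul hMX hMY mulmxA MXM.
have eXM : X *m M = Y *m M.
  rewrite -hXM -{1}MYM -(mulmxA M) mulmxA trmxC_mul hXM hYM.
  by rewrite -mulmxA (mulmxA M) MXM.
by rewrite -XMX eXM -mulmxA eMX mulmxA YMY.
Qed.

Lemma moore_penrose_exists p q (M : 'M[C]_(p, q)) :
  exists X, is_moore_penrose M X.
Proof.
have [r [B [N [-> Bfull Nfree]]]] : exists r (B : 'M[C]_(p, r)) (N : 'M[C]_(r, q)),
    [/\ M = B *m N, row_full B & row_free N].
  exists (\rank M), (col_base M), (row_base M).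
  by rewrite mulmx_base col_base_full row_base_free.
have uN : N *m N ^t* \in unitmx by exact: row_free_gram.
have uB : B ^t* *m B \in unitmx.
  have := @row_free_gram _ _ (B ^t*); rewrite trmxCK; apply.
  by rewrite /row_free mxrank_map mxrank_tr.
pose NR := N ^t* *m invmx (N *m N ^t*); pose BL := invmx (B ^t* *m B) *m B ^t*.
have NNR : N *m NR = 1%:M by rewrite mulmxA mulmxV.
have BLB : BL *m B = 1%:M by rewrite -mulmxA mulVmx.
have MX : B *m N *m (NR *m BL) = B *m BL.
  by rewrite -mulmxA (mulmxA N) NNR mul1mx.
have XM : NR *m BL *m (B *m N) = NR *m N.
  by rewrite -mulmxA (mulmxA BL) BLB mul1mx.
have hinv k (G : 'M[C]_k) : G ^t* = G -> (invmx G) ^t* = invmx G.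
  by move=> hG; rewrite trmx_inv map_invmx hG.
exists (NR *m BL); split.
- by rewrite MX -mulmxA (mulmxA BL) BLB mul1mx.
- by rewrite XM -mulmxA (mulmxA N) NNR mul1mx.
- by rewrite MX !trmxC_mul hinv ?trmxC_mul ?trmxCK// mulmxA.
- by rewrite XM !trmxC_mul hinv ?trmxC_mul ?trmxCK// mulmxA.
Qed.

Lemma moore_penroseP p q (M : 'M[C]_(p, q)) :
  is_moore_penrose M (moore_penrose M).
Proof. exact: (xgetPex 0 (moore_penrose_exists M)). Qed.

End Inverses.

Section RealVariable.
Context {R : realType} {m n : nat}.

(* Matrices over R[i] are a normed module over R[i] but not over R, so the
   library's derivable and derive1 do not apply to functions of a real variable;
   these are the same limits with the real increment h embedded in R[i]. *)
Definition cderivable (f : R -> 'M[R[i]]_(m, n)) (t : R) : Prop :=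
  cvg ((h%:C)^-1 *: (f (h + t) - f t) @[h --> 0^']).

Definition cderive1 (f : R -> 'M[R[i]]_(m, n)) (t : R) : 'M[R[i]]_(m, n) :=
  lim ((h%:C)^-1 *: (f (h + t) - f t) @[h --> 0^']).

Definition local_constant_rank (f : R -> 'M[R[i]]_(m, n)) (J : set R) : Prop :=
  forall t, J t ->
    exists r : nat, \forall s \near within J (nbhs t), \rank (f s) = r.

End RealVariable.

(* Main.v *)
Require Import Defs.
From HB Require Import structures.
From mathcomp Require Import all_boot all_order all_algebra.
From mathcomp Require Import ring.
From mathcomp Require Import complex.
From mathcomp Require Import all_classical all_reals all_analysis.

Set Implicit Arguments.
Unset Strict Implicit.
Unset Printing Implicit Defensive.

Import Order.TTheory GRing.Theory Num.Theory.
Import numFieldNormedType.Exports.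

Local Open Scope classical_set_scope.
Local Open Scope ring_scope.
Local Open Scope complex_scope.

(** Write [P = D D^+] and [Q = E^+ E], with [^+] the Moore-Penrose inverse.  The
    (D,E)-inverse [X] of [A] satisfies [P X = X = X Q], [X A P = P] and
    [Q A X = Q].  For two triples [(A, D, E)] and [(B, D', E')] with inverses
    [X] and [Y], and with [P'], [Q'] the projectors of the second one, these
    identities give the exact difference formula ([de_inverse_sub])
      [X - Y = - X (A - B) Y + X (Q - Q') (1 - B Y) + (1 - X A) (P - P') Y].
    Apply it with the first triple taken at [t0 + h] and the second at [t0].
    On the right-hand side [X] occurs only as a left factor, and each term
    contains the variation of [A], [P] or [Q].  So if [X] stays bounded and [A],
    [P], [Q] are continuous at [t0], the right-hand side tends to 0 and [X] is
    continuous.  Dividing by [h] and passing to the limit then gives the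
    derivative, those of [P] and [Q] being given by the product rule.  The term
    coming from [A] enters with a minus sign, as it must: for [D = E = 1] the
    formula is the derivative of the matrix inverse.

    It remains to differentiate [D^+].  Wedin's identity ([moore_penrose_sub])
    is a difference formula of the same shape, so the same argument applies once
    [D^+] is known to be bounded near [t0].  This is where the rank is used.  If
    [M] is close to [N] and has the same rank, then [Z = 1 + (M - N) N^+] is
    invertible and [N^+ Z^-1] is an inner inverse of [M]
    ([inner_inverse_rank]); it is bounded because [Z] is close to 1.  Finally
    [M^+ = (M^+ M) Y (M M^+)] for any inner inverse [Y], and the entries of an
    orthogonal projector have modulus at most 1, so [M^+] is bounded as well
    ([bounded_moore_penrose]).

    Limits are taken along an arbitrary proper filter, with difference quotients
    by a scalar function tending to 0; the theorem is the case of [h%:C] as [h]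
    tends to 0. *)

(** * Algebraic identities *)

Local Open Scope sesquilinear_scope.

(** Put [Z = 1 + (M - N) X].  Since [N X N = N], [Z N = M X N], so the columns
    of [Z N] lie in the column space of [M]; as [Z] is invertible, the ranks
    agree and the two column spaces coincide, that is [M = Z N W] for some [W].
    Hence [M X Z^-1 M = M X N W = Z N W = M]. *)
Lemma inner_inverse_rank (F : fieldType) m n (M N : 'M[F]_(m, n))
    (X : 'M[F]_(n, m)) :
    N *m X *m N = N -> \rank M = \rank N ->
    1%:M + (M - N) *m X \in unitmx ->
  M *m (X *m invmx (1%:M + (M - N) *m X)) *m M = M.
Proof.
move=> NXN rMN; set Z := 1%:M + _ => uZ.
have MXN : M *m X *m N = Z *m N.
  by rewrite mulmxDl mul1mx mulmxBl mulmxBl NXN addrC subrK.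
have /submxP[W] : (M^T <= (Z *m N)^T)%MS.
  have sub : ((Z *m N)^T <= M^T)%MS.
    by rewrite -MXN -mulmxA trmx_mul submxMl.
  rewrite -(mxrank_leqif_sup sub) !mxrank_tr rMN.
  by rewrite -[in \rank (Z *m N)]mxrank_tr trmx_mul mxrankMfree
    ?mxrank_tr// row_free_unit unitmx_tr.
move=> /(congr1 trmx); rewrite trmx_mul !trmxK => MW.
have -> : M *m (X *m invmx Z) *m M = M *m X *m (invmx Z *m Z) *m N *m W^T.
  by rewrite [X in _ *m X]MW !mulmxA.
by rewrite mulVmx// mulmx1 MXN -MW.
Qed.

Section Algebra.
Variable K : numClosedFieldType.

Lemma trmxCB m n (M N : 'M[K]_(m, n)) : (M - N) ^t* = M ^t* - N ^t*.
Proof. by apply/matrixP => i j; rewrite !mxE rmorphB. Qed.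

(** Wedin's identity.  The conjugate transpose of [N] is killed on the right by
    [1 - N G], and that of [M] on the left by [1 - F M]; so each difference
    [M - N] in the last two terms contributes through a single matrix. *)
Lemma moore_penrose_sub m n (M N : 'M[K]_(m, n)) :
  let F := moore_penrose M in let G := moore_penrose N in
  F - G = - (F *m (M - N) *m G)
        + F *m F ^t* *m (M - N) ^t* *m (1%:M - N *m G)
        + (1%:M - F *m M) *m (M - N) ^t* *m (G ^t* *m G).
Proof.
move=> F G.
have [MFM FMF hMF hFM] : is_moore_penrose M F := moore_penroseP M.
have [NGN GNG hNG hGN] : is_moore_penrose N G := moore_penroseP N.
have FFM : F *m F ^t* *m M ^t* = F by rewrite -mulmxA -trmxC_mul hMF mulmxA.
have NNG : N ^t* *m (1%:M - N *m G) = 0.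
  by rewrite -hNG mulmxBr mulmx1 -trmxC_mul NGN subrr.
have NGG : N ^t* *m (G ^t* *m G) = G by rewrite mulmxA -trmxC_mul hGN GNG.
have FMM : (1%:M - F *m M) *m M ^t* = 0.
  by rewrite -hFM mulmxBl mul1mx -trmxC_mul mulmxA MFM subrr.
have e1 : F *m (M - N) *m G = F *m M *m G - F *m N *m G.
  by rewrite mulmxBr mulmxBl.
have e2 : F *m F ^t* *m (M - N) ^t* *m (1%:M - N *m G) = F - F *m N *m G.
  rewrite trmxCB [_ *m (_ - N ^t*)]mulmxBr mulmxBl FFM.
  rewrite -(mulmxA _ (N ^t*)) NNG mulmx0.
  by rewrite subr0 mulmxBr mulmx1 mulmxA.
have e3 : (1%:M - F *m M) *m (M - N) ^t* *m (G ^t* *m G) = F *m M *m G - G.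
  rewrite trmxCB mulmxBr FMM sub0r mulNmx -(mulmxA _ (N ^t*)) NGG.
  by rewrite mulmxBl mul1mx opprB.
by rewrite e1 e2 e3; apply/matrixP => i j; rewrite !mxE; ring.
Qed.

(** The inclusions of column and null spaces, restated through the orthogonal
    projectors: in this form they can be used in matrix products. *)
Lemma de_inverse_proj n m (A : 'M[K]_(n, m)) (D E X : 'M[K]_(m, n)) :
    is_de_inverse A D E X ->
  D *m moore_penrose D *m X = X /\ X *m (moore_penrose E *m E) = X.
Proof.
move=> [_ _ RX NX].
have [DFD _ _ _] := moore_penroseP D; have [EGE _ _ _] := moore_penroseP E.
split; apply: mulmx_cV_inj => x.
  have [|z _ Dz] := RX (X *m x); first by exists x.
  by rewrite -mulmxA -Dz mulmxA DFD.
apply/eqP; rewrite eq_sym -subr_eq0 -mulmxA -mulmxBr; apply/eqP/NX.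
by rewrite /nullspace/= mulmxBr !mulmxA EGE subrr.
Qed.

(** [X (A - B) Y] is the difference of [X A Y] and [X B Y]; inserting
    [Y = P' Y] in the first and [X = X Q] in the second expresses each of them
    through the variation of the projectors. *)
Lemma de_inverse_sub n m (A B : 'M[K]_(n, m)) (D E D' E' X Y : 'M[K]_(m, n)) :
    is_de_inverse A D E X -> is_de_inverse B D' E' Y ->
  X - Y = - (X *m (A - B) *m Y)
    + X *m (moore_penrose E *m E - moore_penrose E' *m E') *m (1%:M - B *m Y)
    + (1%:M - X *m A) *m (D *m moore_penrose D - D' *m moore_penrose D') *m Y.
Proof.
move=> HX HY; have [PX XQ] := de_inverse_proj HX.
have [PY YQ] := de_inverse_proj HY.
have [XAD _ _ _] := HX; have [_ EBY _ _] := HY.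
have XAP : X *m A *m (D *m moore_penrose D) = D *m moore_penrose D.
  by rewrite mulmxA XAD.
have QBY : moore_penrose E' *m E' *m (B *m Y) = moore_penrose E' *m E'.
  by rewrite -!mulmxA (mulmxA E') EBY.
set P := D *m _ in PX XAP *; set P' := D' *m _ in PY *.
set Q := _ *m E in XQ *; set Q' := _ *m E' in YQ QBY *.
have e1 : X *m (A - B) *m Y = X *m A *m Y - X *m B *m Y.
  by rewrite mulmxBr mulmxBl.
have e2 : X *m (Q - Q') *m (1%:M - B *m Y) = X - X *m B *m Y.
  rewrite [X *m (_ - _)]mulmxBr XQ mulmxBl -(mulmxA X Q').
  rewrite [Q' *m (_ - _)]mulmxBr QBY mulmx1.
  by rewrite subrr mulmx0 subr0 mulmxBr mulmx1 mulmxA.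
have e3 : (1%:M - X *m A) *m (P - P') *m Y = X *m A *m Y - Y.
  rewrite mulmxBr mulmxBl [_ *m P]mulmxBl XAP mul1mx subrr mul0mx sub0r.
  by rewrite -mulmxA PY mulmxBl mul1mx opprB.
by rewrite e1 e2 e3; apply/matrixP => i j; rewrite !mxE; ring.
Qed.

End Algebra.

(** Both difference formulas have the shape of the right-hand side; the
    left-hand side isolates the factor [X], about which only a bound is known at
    first. *)
Lemma mulmx_affine (R : comNzRingType) m n (X : 'M[R]_(m, n)) (B : 'M[R]_(n, m))
    (M1 M2 : 'M[R]_n) (M3 : 'M[R]_(m, n)) :
  X *m (- M1 + M2 - B *m M3) + M3
    = - (X *m M1) + X *m M2 + (1%:M - X *m B) *m M3.
Proof.
rewrite mulmxBr mulmxDr mulmxN mulmxBl mul1mx mulmxA.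
by rewrite -!addrA; do 2 congr (_ + _); exact: addrC.
Qed.

(** * Bounds in the entrywise norm *)

Section Norm.
Variable K : numFieldType.

Lemma mx_norm_ge_coord m n (M : 'M[K]_(m, n)) i j : `|M i j| <= `|M|.
Proof.
have -> : `|M| = mx_norm M by []; rewrite mx_normE -[leLHS]nngE num_le.
exact: (le_bigmax _ _ (i, j)).
Qed.

Lemma mx_norm_leP m n (M : 'M[K]_(m, n)) (c : K) :
  0 <= c -> `|M| <= c <-> forall i j, `|M i j| <= c.
Proof.
move=> c0; split=> [Mc i j|Mc]; first
  exact: le_trans (mx_norm_ge_coord _ _ _) Mc.
have -> : `|M| = mx_norm M by [].
by have [->//|/mx_norm_neq0[i ->]//] := eqVneq (mx_norm M) 0.
Qed.

Lemma mx_norm_mul m n p (M : 'M[K]_(m, n)) (N : 'M[K]_(n, p)) :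
  `|M *m N| <= n%:R * `|M| * `|N|.
Proof.
apply/mx_norm_leP => [|i k]; first by rewrite !mulr_ge0.
rewrite mxE (le_trans (ler_norm_sum _ _ _))//.
have -> : n%:R * `|M| * `|N| = \sum_(j < n) `|M| * `|N|.
  by rewrite sumr_const card_ord -mulrA mulr_natl.
by rewrite ler_sum// => j _; rewrite normrM ler_pM// mx_norm_ge_coord.
Qed.

(** From [V = V (1 + T) - V T], where the last term has norm at most half that
    of [V].  With [V] the kernel of [1 + T] this shows that [1 + T] is
    invertible, and with [V] its inverse it bounds that inverse. *)
Lemma mx_norm_mul_near1 m n (V : 'M[K]_(m, n)) (T : 'M[K]_n) :
  n%:R * `|T| <= 2^-1 -> `|V| <= 2 * `|V *m (1%:M + T)|.
Proof.
move=> T2; have le : `|V| <= `|V *m (1%:M + T)| + `|V| / 2.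
  rewrite -[in leLHS](_ : V *m (1%:M + T) - V *m T = V); last first.
    by rewrite mulmxDr mulmx1 addrK.
  rewrite (le_trans (ler_normB _ _))// lerD2l (le_trans (mx_norm_mul _ _))//.
  by rewrite mulrAC mulrC ler_wpM2l.
by rewrite mulrC -ler_pdivrMr// -(lerD2r (`|V| / 2)) -splitr.
Qed.

Lemma unitmx_near1 n (T : 'M[K]_n) :
  n%:R * `|T| <= 2^-1 -> 1%:M + T \in unitmx.
Proof.
move=> T2; rewrite -row_free_unit -kermx_eq0 -normr_le0.
by rewrite (le_trans (mx_norm_mul_near1 _ T2))// mulmx_ker normr0 mulr0.
Qed.

Lemma mx_norm1_le n : `|1%:M : 'M[K]_n| <= 1.
Proof.
by apply/mx_norm_leP => // i j; rewrite mxE normr_nat; case: eqP.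
Qed.

Lemma mx_norm_inv_near1 n (T : 'M[K]_n) :
  n%:R * `|T| <= 2^-1 -> `|invmx (1%:M + T)| <= 2.
Proof.
move=> T2; rewrite (le_trans (mx_norm_mul_near1 _ T2))//.
by rewrite mulVmx ?unitmx_near1// ler_piMr// mx_norm1_le.
Qed.

End Norm.

Section Projector.
Variable K : numClosedFieldType.

(** A diagonal entry of [P = P P^t*] is the sum of the squared moduli of the
    entries in its row.  In particular [P i i ^+ 2 <= P i i], so that
    [P i i <= 1], and then every entry of the row has modulus at most 1. *)
Lemma mx_norm_projector n (P : 'M[K]_n) :
  P ^t* = P -> P *m P = P -> `|P| <= 1.
Proof.
move=> hP PP; apply/mx_norm_leP => // i j.
have Pii : P i i = \sum_k `|P i k| ^+ 2.
  rewrite -{1}PP mxE; apply: eq_bigr => k _.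
  by rewrite -{2}hP !mxE normCK.
have Pii0 : 0 <= P i i by rewrite Pii sumr_ge0.
have le k : `|P i k| ^+ 2 <= P i i.
  by rewrite [leRHS]Pii (bigD1 k)//= lerDl sumr_ge0.
have Pii1 : P i i <= 1.
  have [->|Pn0] := eqVneq (P i i) 0; first exact: ler01.
  rewrite -(ler_pM2l (_ : 0 < P i i)) ?lt0r ?Pn0// mulr1 -expr2.
  by rewrite -{1}(ger0_norm Pii0) le.
by rewrite -(@ler_pXn2r _ 2)// ?nnegrE// expr1n (le_trans (le j)).
Qed.

(** [F = (F M) Y (M F)], and both outer factors are orthogonal projectors. *)
Lemma moore_penrose_le m n (M : 'M[K]_(m, n)) (Y : 'M[K]_(n, m)) :
  M *m Y *m M = M -> `|moore_penrose M| <= m%:R * n%:R * `|Y|.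
Proof.
move=> MYM; set F := moore_penrose M.
have [MFM FMF hMF hFM] : is_moore_penrose M F := moore_penroseP M.
have -> : F = F *m M *m Y *m (M *m F).
  by rewrite -{1}FMF -{1}MYM !mulmxA.
have P1 : `|F *m M| <= 1 by rewrite mx_norm_projector// mulmxA FMF.
have P2 : `|M *m F| <= 1 by rewrite mx_norm_projector// mulmxA MFM.
rewrite (le_trans (mx_norm_mul _ _))// -!mulrA ler_wpM2l//.
rewrite (le_trans (ler_piMr _ P2))// (le_trans (mx_norm_mul _ _))//.
by rewrite -mulrA ler_wpM2l// ler_piMl.
Qed.

End Projector.

(** * Limits of matrix-valued functions *)

Section Convergence.
Context {K : numFieldType} {T : Type} {F : set_system T} {FF : Filter F}.

Lemma cvg_mxP m n (f : T -> 'M[K]_(m, n)) (a : 'M[K]_(m, n)) :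
  f x @[x --> F] --> a <-> forall i j, f x i j @[x --> F] --> a i j.
Proof.
split=> [/cvgrPdist_le fa i j|fa].
  apply/cvgrPdist_le => e /fa; apply: filterS => x; apply: le_trans.
  by have := mx_norm_ge_coord (a - f x) i j; rewrite !mxE.
apply/cvgrPdist_le => e e0.
have : \forall x \near F, forall i j, `|a i j - f x i j| <= e.
  apply: filter_forall => i; apply: filter_forall => j.
  by have /cvgrPdist_le := fa i j; exact.
apply: filterS => x xe; apply/mx_norm_leP => [|i j]; first exact: ltW.
by rewrite !mxE.
Qed.

Lemma cvg_mulmx m n p (f : T -> 'M[K]_(m, n)) (g : T -> 'M[K]_(n, p))
    (a : 'M[K]_(m, n)) (b : 'M[K]_(n, p)) :
  f x @[x --> F] --> a -> g x @[x --> F] --> b ->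
  f x *m g x @[x --> F] --> a *m b.
Proof.
move=> /cvg_mxP fa /cvg_mxP gb; apply/cvg_mxP => i k.
under eq_fun do rewrite mxE; rewrite mxE.
apply: cvg_big => [|j _]; last exact: cvgM.
exact: add_continuous.
Qed.

Lemma cvg_mulmx_bounded m n p (f : T -> 'M[K]_(m, n)) (g : T -> 'M[K]_(n, p)) :
  bounded_near f F -> g x @[x --> F] --> (0 : 'M[K]_(n, p)) ->
  f x *m g x @[x --> F] --> (0 : 'M[K]_(m, p)).
Proof.
move=> /pinfty_ex_gt0[c c0 fc] g0; apply/cvgr0Pnorm_le => e e0.
(* the [+ 1] keeps the denominator positive when [n = 0] *)
have d0 : 0 < e / (n%:R * c + 1).
  by rewrite divr_gt0// ltr_wpDl// mulr_ge0// ltW.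
move/cvgr0Pnorm_le/(_ _ d0): g0; apply: filterS2 fc => x fc gd.
rewrite (le_trans (mx_norm_mul _ _))//.
rewrite (le_trans (ler_pM _ _ (ler_wpM2l _ fc) gd))//.
rewrite mulrA ler_pdivrMr ?(mulrC e) ?ler_wpM2r ?lerDl ?ltW//.
by rewrite ltr_wpDl// mulr_ge0// ltW.
Qed.

(** Boundedness makes up for the unknown behaviour of [f x] on the right-hand
    side, where it multiplies a quantity tending to 0. *)
Lemma cvg_affine_bounded m n (f : T -> 'M[K]_(m, n)) (l : 'M[K]_(m, n))
    (a : T -> 'M[K]_n) (b : T -> 'M[K]_(m, n)) :
    bounded_near f F ->
    (\forall x \near F, f x - l = f x *m a x + b x) ->
    a x @[x --> F] --> (0 : 'M[K]_n) -> b x @[x --> F] --> (0 : 'M[K]_(m, n)) ->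
  f x @[x --> F] --> l.
Proof.
move=> fB fE a0 b0; apply/subr_cvg0.
rewrite -[X in _ --> X]addr0.
apply: cvg_trans (cvgD (cvg_mulmx_bounded fB a0) b0).
by apply: near_eq_cvg; apply: filterS fE => x ->.
Qed.

End Convergence.

Lemma cvg_trmxC (K : numClosedFieldType) {T : Type} {F : set_system T}
    {FF : Filter F} m n (f : T -> 'M[K]_(m, n)) (a : 'M[K]_(m, n)) :
  f x @[x --> F] --> a -> (f x) ^t* @[x --> F] --> a ^t*.
Proof.
move=> /cvg_mxP fa; apply/cvg_mxP => i j; rewrite !mxE.
under eq_fun do rewrite !mxE.
apply/cvgrPdist_le => e e0; have /cvgrPdist_le/(_ _ e0) := fa j i.
by apply: filterS => x; rewrite -rmorphB norm_conjC.
Qed.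

Lemma bounded_trmxC (K : numClosedFieldType) {T : Type} {F : set_system T}
    {FF : Filter F} m n (f : T -> 'M[K]_(m, n)) :
  bounded_near f F -> bounded_near (fun x => (f x) ^t*) F.
Proof.
rewrite /bounded_near; apply: filterS => c; apply: filterS => x.
apply: le_trans; apply/mx_norm_leP => // i j.
by rewrite !mxE norm_conjC mx_norm_ge_coord.
Qed.

(** Constancy of the rank is essential: a scalar tending to 0 without vanishing
    has an unbounded inverse.  Here it provides the inner inverse of
    [inner_inverse_rank], which stays bounded. *)
Lemma bounded_moore_penrose (K : numClosedFieldType) {T : Type}
    {F : set_system T} {FF : ProperFilter F} m n (f : T -> 'M[K]_(m, n))
    (a : 'M[K]_(m, n)) :
    f x @[x --> F] --> a -> (\forall x \near F, \rank (f x) = \rank a) ->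
  bounded_near (fun x => moore_penrose (f x)) F.
Proof.
move=> fa fr; set X := moore_penrose a.
have [aXa _ _ _] : is_moore_penrose a X := moore_penroseP a.
have T0 : (f x - a) *m X @[x --> F] --> (0 : 'M[K]_m).
  rewrite -[X in _ --> X](mul0mx m X); apply: cvg_mulmx; last exact: cvg_cst.
  exact/subr_cvg0.
(* [m.+1] rather than [m], so that the threshold is positive when [m = 0] *)
have e0 : 0 < (2 * m.+1%:R : K)^-1 by rewrite invr_gt0 mulr_gt0.
apply/ex_bound; exists (m%:R * n%:R * (m%:R * `|X| * 2)).
move/cvgr0Pnorm_le/(_ _ e0): T0; apply: filterS2 fr => x rx Tx.
have T2 : m%:R * `|(f x - a) *m X| <= 2^-1.
  rewrite (le_trans (ler_wpM2l _ Tx))// invfM mulrCA.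
  by rewrite ler_piMr// ler_pdivrMr// mul1r ler_nat.
have := inner_inverse_rank aXa rx (unitmx_near1 T2).
move=> /moore_penrose_le /le_trans; apply.
rewrite ler_wpM2l ?mulr_ge0//(le_trans (mx_norm_mul _ _))//.
by rewrite ler_wpM2l ?mulr_ge0// mx_norm_inv_near1.
Qed.

(** * Difference quotients *)

Section Slope.
Context {K : numClosedFieldType} {T : Type} {F : set_system T}.
Context {FF : ProperFilter F}.
Variable s : T -> K.
Hypothesis s_cvg0 : s x @[x --> F] --> (0 : K).
Hypothesis s_neq0 : \forall x \near F, s x != 0.
Hypothesis s_real : forall x, s x \is Num.real.

(** Over [R[i]], with [s h = h%:C] and [f] precomposed with the translation by
    [t], this is the difference quotient at [t].  The base value [a] is a
    separate argument because [T] has no base point, only a filter. *)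
Definition slope m n (f : T -> 'M[K]_(m, n)) (a : 'M[K]_(m, n)) (x : T) :
  'M[K]_(m, n) := (s x)^-1 *: (f x - a).

Definition has_slope m n (f : T -> 'M[K]_(m, n)) (a d : 'M[K]_(m, n)) : Prop :=
  slope f a x @[x --> F] --> d.

Lemma has_slope_cvg m n (f : T -> 'M[K]_(m, n)) (a d : 'M[K]_(m, n)) :
  has_slope f a d -> f x @[x --> F] --> a.
Proof.
move=> fd; apply/subr_cvg0; rewrite -[X in _ --> X](scale0r d).
apply: cvg_trans (cvgZ s_cvg0 fd); apply: near_eq_cvg.
by apply: filterS s_neq0 => x sx; rewrite /slope scalerA divff ?scale1r.
Qed.

Lemma has_slope_eq m n (f q : T -> 'M[K]_(m, n)) (a d : 'M[K]_(m, n)) :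
    (\forall x \near F, slope f a x = q x) ->
  q x @[x --> F] --> d -> has_slope f a d.
Proof.
move=> fq; apply: cvg_trans; apply: near_eq_cvg.
by apply: filterS fq => x ->.
Qed.

Lemma has_slopeM m n p (f : T -> 'M[K]_(m, n)) (g : T -> 'M[K]_(n, p))
    (a df : 'M[K]_(m, n)) (b dg : 'M[K]_(n, p)) :
    has_slope f a df -> has_slope g b dg ->
  has_slope (fun x => f x *m g x) (a *m b) (df *m b + a *m dg).
Proof.
move=> fd gd; apply: (@has_slope_eq _ _ _
    (fun x => slope f a x *m b + f x *m slope g b x)).
  apply: nearW => x; rewrite /slope -scalemxAl -scalemxAr -scalerDr.
  by rewrite mulmxBl mulmxBr [X in _ = _ *: X]addrC subrKA.
apply: cvgD; apply: cvg_mulmx => //; first exact: cvg_cst.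
exact: has_slope_cvg fd.
Qed.

(** Conjugation does not affect the increment [s x], which is real: this is why
    the conjugate transpose of a differentiable function of a real variable is
    again differentiable. *)
Lemma slope_trmxC m n (f : T -> 'M[K]_(m, n)) (a : 'M[K]_(m, n)) x :
  (slope f a x) ^t* = (s x)^-1 *: (f x - a) ^t*.
Proof.
apply/matrixP => i j; rewrite !mxE rmorphM fmorphV/=.
by congr (_^-1 * _); exact/CrealP.
Qed.

(** Boundedness gives continuity through [cvg_affine_bounded], and continuity
    gives the limit of the difference quotient; both steps read off Wedin's
    identity. *)
Lemma has_slope_moore_penrose m n (f : T -> 'M[K]_(m, n)) (a d : 'M[K]_(m, n)) :
    has_slope f a d -> (\forall x \near F, \rank (f x) = \rank a) ->
  exists d', has_slope (fun x => moore_penrose (f x)) (moore_penrose a) d'.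
Proof.
move=> fd fr; have fc := has_slope_cvg fd.
set g := fun x => moore_penrose (f x); set b := moore_penrose a.
have gb : bounded_near g F by exact: bounded_moore_penrose fc fr.
have df0 : f x - a @[x --> F] --> (0 : 'M[K]_(m, n)) by exact/subr_cvg0.
have dfC0 : (f x - a) ^t* @[x --> F] --> (0 : 'M[K]_(n, m)).
  have -> : (0 : 'M[K]_(n, m)) = 0 ^t* by rewrite trmx0 map_mx0.
  exact: cvg_trmxC.
have gc : g x @[x --> F] --> b.
  apply: (cvg_affine_bounded (a := fun x => - ((f x - a) *m b)
      + (g x) ^t* *m ((f x - a) ^t* *m (1%:M - a *m b))
      - f x *m ((f x - a) ^t* *m (b ^t* *m b)))
    (b := fun x => (f x - a) ^t* *m (b ^t* *m b)) gb).
  - apply: nearW => x; rewrite moore_penrose_sub -/b -/(g x).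
    by rewrite mulmx_affine !mulmxA.
  - have -> : (0 : 'M[K]_m) = - (0 *m b) + 0 - a *m (0 *m (b ^t* *m b)).
      by rewrite !mul0mx mulmx0 oppr0 !addr0.
    apply: cvgB; first apply: cvgD.
    + by apply: cvgN; apply: cvg_mulmx => //; exact: cvg_cst.
    + apply: cvg_mulmx_bounded; first exact: bounded_trmxC.
      rewrite -[X in _ --> X](mul0mx _ (1%:M - a *m b)).
      by apply: cvg_mulmx => //; exact: cvg_cst.
    + by apply: cvg_mulmx => //; apply: cvg_mulmx => //; exact: cvg_cst.
  - rewrite -[X in _ --> X](mul0mx _ (b ^t* *m b)).
    by apply: cvg_mulmx => //; exact: cvg_cst.
have qC : (slope f a x) ^t* @[x --> F] --> d ^t* by exact: cvg_trmxC.
have gC : (g x) ^t* @[x --> F] --> b ^t* by exact: cvg_trmxC.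
exists (- (b *m d *m b) + b *m b ^t* *m d ^t* *m (1%:M - a *m b)
  + (1%:M - b *m a) *m d ^t* *m (b ^t* *m b)).
apply: (@has_slope_eq _ _ _ (fun x => - (g x *m slope f a x *m b)
    + g x *m (g x) ^t* *m (slope f a x) ^t* *m (1%:M - a *m b)
    + (1%:M - g x *m f x) *m (slope f a x) ^t* *m (b ^t* *m b))).
  apply: nearW => x; rewrite slope_trmxC /slope moore_penrose_sub 2!scalerDr.
  by rewrite -!scalemxAr -!scalemxAl scalerN.
apply: cvgD; first apply: cvgD.
- apply: cvgN; apply: cvg_mulmx; last exact: cvg_cst.
  exact: cvg_mulmx.
- apply: cvg_mulmx; last exact: cvg_cst.
  exact: cvg_mulmx (cvg_mulmx gc gC) qC.
- apply: cvg_mulmx; last exact: cvg_cst.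
  apply: cvg_mulmx => //; apply: cvgB; first exact: cvg_cst.
  exact: cvg_mulmx.
Qed.

(** The same two steps as for the Moore-Penrose inverse, now from
    [de_inverse_sub] and with the boundedness of [X] assumed. *)
Lemma has_slope_de_inverse m n (A : T -> 'M[K]_(n, m))
    (D E X : T -> 'M[K]_(m, n)) (A0 dA : 'M[K]_(n, m))
    (D0 E0 X0 dD dE : 'M[K]_(m, n)) (dF dG : 'M[K]_(n, m)) :
    has_slope A A0 dA -> has_slope D D0 dD -> has_slope E E0 dE ->
    has_slope (fun x => moore_penrose (D x)) (moore_penrose D0) dF ->
    has_slope (fun x => moore_penrose (E x)) (moore_penrose E0) dG ->
    (\forall x \near F, is_de_inverse (A x) (D x) (E x) (X x)) ->
    is_de_inverse A0 D0 E0 X0 -> bounded_near X F ->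
  has_slope X X0
    (X0 *m (dG *m E0 + moore_penrose E0 *m dE) *m (1%:M - A0 *m X0)
     + (1%:M - X0 *m A0) *m (dD *m moore_penrose D0 + D0 *m dF) *m X0
     - X0 *m dA *m X0).
Proof.
move=> Ad Dd Ed Fd Gd XI X0I Xb.
set P := fun x => D x *m moore_penrose (D x); set P0 := D0 *m moore_penrose D0.
set Q := fun x => moore_penrose (E x) *m E x; set Q0 := moore_penrose E0 *m E0.
have Pd : has_slope P P0 (dD *m moore_penrose D0 + D0 *m dF).
  exact: has_slopeM.
have Qd : has_slope Q Q0 (dG *m E0 + moore_penrose E0 *m dE).
  exact: has_slopeM.
move: (dD *m _ + _) (dG *m _ + _) => dP dQ in Pd Qd *.
have Ac := has_slope_cvg Ad; have Pc := has_slope_cvg Pd.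
have Qc := has_slope_cvg Qd.
have XE : \forall x \near F, X x - X0 = - (X x *m (A x - A0) *m X0)
    + X x *m (Q x - Q0) *m (1%:M - A0 *m X0)
    + (1%:M - X x *m A x) *m (P x - P0) *m X0.
  by apply: filterS XI => x XI; exact: de_inverse_sub.
have Xc : X x @[x --> F] --> X0.
  apply: (cvg_affine_bounded (a := fun x => - ((A x - A0) *m X0)
      + (Q x - Q0) *m (1%:M - A0 *m X0) - A x *m ((P x - P0) *m X0))
    (b := fun x => (P x - P0) *m X0) Xb).
  - apply: filterS XE => x ->.
    by rewrite mulmx_affine !mulmxA.
  - have -> : (0 : 'M[K]_n) =
        - (0 *m X0) + 0 *m (1%:M - A0 *m X0) - A0 *m (0 *m X0).
      by rewrite !mul0mx mulmx0 oppr0 !addr0.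
    apply: cvgB; first apply: cvgD.
    + apply: cvgN; apply: cvg_mulmx; last exact: cvg_cst.
      exact/subr_cvg0.
    + by apply: cvg_mulmx; [exact/subr_cvg0|exact: cvg_cst].
    + apply: cvg_mulmx => //.
      by apply: cvg_mulmx; [exact/subr_cvg0|exact: cvg_cst].
  - rewrite -[X in _ --> X](mul0mx _ X0).
    by apply: cvg_mulmx; [exact/subr_cvg0|exact: cvg_cst].
apply: (@has_slope_eq _ _ _ (fun x =>
    X x *m slope Q Q0 x *m (1%:M - A0 *m X0)
    + (1%:M - X x *m A x) *m slope P P0 x *m X0
    - X x *m slope A A0 x *m X0)).
  apply: filterS XE => x XE; rewrite /slope XE 2!scalerDr.
  by rewrite -!scalemxAr -!scalemxAl scalerN [RHS]addrC addrA.
apply: cvgB; first apply: cvgD.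
- apply: cvg_mulmx; last exact: cvg_cst.
  exact: cvg_mulmx.
- apply: cvg_mulmx; last exact: cvg_cst.
  apply: cvg_mulmx => //; apply: cvgB; first exact: cvg_cst.
  exact: cvg_mulmx.
- apply: cvg_mulmx; last exact: cvg_cst.
  exact: cvg_mulmx.
Qed.

End Slope.

(** * Functions of a real variable *)

Section RealVariable.
Variable R : realType.

(** The type ascriptions select the topology that [R[i]] carries as a field with
    a norm. *)
Lemma cvg_real_complex0 :
  (h%:C : (R[i] : numClosedFieldType)) @[h --> (0 : R)^'] -->
    (0 : (R[i] : numClosedFieldType)).
Proof.
apply/cvgr0Pnorm_le => -[e e'] /=; rewrite ltcE/= => /andP[/eqP -> e0].
near=> h; rewrite normc_def/= expr0n/= addr0 sqrtr_sqr lecR.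
near: h; exact: (@dnbhs0_le _ R).
Unshelve. all: by end_near. Qed.

End RealVariable.
Local Close Scope sesquilinear_scope.

Theorem theorem8p5 (R : realType) (m n : nat) (J : set R) (t0 : R)
  (A : R -> 'M[R[i]]_(n, m)) (D E : R -> 'M[R[i]]_(m, n))
  (J_open : open J) (J_t0 : J t0)
  (ADE_inv : forall t, J t -> de_invertible (A t) (D t) (E t))
  (A_diff : cderivable A t0)
  (D_diff : cderivable D t0)
  (E_diff : cderivable E t0)
  (f_bounded : [bounded de_inverse (A t) (D t) (E t) | t in J])
  (D_rank : local_constant_rank D J)
  (E_rank : local_constant_rank E J) :
  let f := fun t => de_inverse (A t) (D t) (E t) in
  let F := fun t => moore_penrose (D t) in
  let G := fun t => moore_penrose (E t) in
  [/\ cderivable F t0, cderivable G t0, cderivable f t0 &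
    cderive1 f t0 =
      f t0 *m (cderive1 G t0 *m E t0 + G t0 *m cderive1 E t0)
           *m (1%:M - A t0 *m f t0)
    + (1%:M - f t0 *m A t0)
           *m (cderive1 D t0 *m F t0 + D t0 *m cderive1 F t0) *m f t0
    - f t0 *m cderive1 A t0 *m f t0].
Proof.
move=> f F G.
pose K : numClosedFieldType := R[i].
pose s (h : R) : K := h%:C.
have sc : s h @[h --> 0^'] --> (0 : K) by exact: cvg_real_complex0.
have sN0 : \forall h \near (0 : R)^', s h != 0.
  near=> h; rewrite /s (inj_eq (@complexI R)); near: h; exact: nbhs_dnbhs_neq.
have sR h : s h \is Num.real by apply/complex_realP; exists h.
have t0c : h + t0 @[h --> (0 : R)^'] --> t0.
  rewrite -[X in _ --> X]add0r; apply: cvgD; last exact: cvg_cst.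
  by move=> P; exact: nbhs_dnbhs.
have nearJ : \forall h \near (0 : R)^', J (h + t0).
  exact: t0c (open_nbhs_nbhs (conj J_open J_t0)).
have rk (M : R -> 'M[K]_(m, n)) : local_constant_rank M J ->
    \forall h \near (0 : R)^', \rank (M (h + t0)) = \rank (M t0).
  move=> /(_ t0 J_t0)[r Mr].
  have {}Mr : \forall t \near t0, \rank (M t) = r.
    have tJ : nbhs t0 J by exact: open_nbhs_nbhs.
    have {}Mr : nbhs t0 (fun t => J t -> \rank (M t) = r) by [].
    by apply: filterS2 tJ Mr => t Jt; exact.
  have rt0 : \rank (M t0) = r by exact: nbhs_singleton Mr.
  have Mh : \forall h \near (0 : R)^', \rank (M (h + t0)) = r by exact: t0c Mr.
  by apply: filterS Mh => h; rewrite rt0.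
have slopeP p q (M : R -> 'M[K]_(p, q)) d :
    has_slope (F := 0^') s (fun h => M (h + t0)) (M t0) d ->
    cderivable M t0 /\ cderive1 M t0 = d.
  move=> Md; split; first by apply/cvg_ex; exists d.
  by apply: cvg_lim Md; exact: norm_hausdorff.
have slope_cderive1 p q (M : R -> 'M[K]_(p, q)) : cderivable M t0 ->
    has_slope (F := 0^') s (fun h => M (h + t0)) (M t0) (cderive1 M t0) by [].
have Ad := slope_cderive1 _ _ A A_diff.
have Dd := slope_cderive1 _ _ D D_diff.
have Ed := slope_cderive1 _ _ E E_diff.
have [dF Fd] := has_slope_moore_penrose sc sN0 sR Dd (rk D D_rank).
have [dG Gd] := has_slope_moore_penrose sc sN0 sR Ed (rk E E_rank).
have fb : bounded_near (fun h => f (h + t0)) 0^'.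
  move: f_bounded; rewrite /bounded_near.
  by apply: filterS => c fc; apply: filterS nearJ => h; exact: fc.
have fI : \forall h \near (0 : R)^',
    is_de_inverse (A (h + t0)) (D (h + t0)) (E (h + t0)) (f (h + t0)).
  by apply: filterS nearJ => h /ADE_inv/de_inverseP.
have fd := has_slope_de_inverse sc sN0 Ad Dd Ed Fd Gd
  fI (de_inverseP (ADE_inv _ J_t0)) fb.
have [Fder FE] : cderivable F t0 /\ cderive1 F t0 = dF := @slopeP _ _ F dF Fd.
have [Gder GE] : cderivable G t0 /\ cderive1 G t0 = dG := @slopeP _ _ G dG Gd.
have [fder fE] := @slopeP _ _ f _ (fd _).
split; [exact: Fder|exact: Gder|exact: fder|].
rewrite fE FE GE; reflexivity.
Unshelve. all: by end_near. Qed.
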